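(* Let $X$ be an operator-stable-like (OSL) process on $\mathbb{R}^d$ with bounded admissible exponent $E$, where $\frac12<a\le\lambda(x)$ and $\Lambda(x)\le b<\infty$ for all $x\in\mathbb{R}^d$. Put $k_0=\left(\arccos\sqrt{2/3}\right)^{-1}$. Then there exist $C_1,C_2>0$ such that (i) for all $x\in\mathbb{R}^d$, $t>0$ and $R\ge\frac1{k_0}$: $$\mathbb{P}^x\Big(\sup_{s\le t}\|X_s-x\|\le R\Big)\le\frac{C_1}{t}R^{1/a};$$ (ii) for all $x\in\mathbb{R}^d$, $t>0$ and $0<R\le\frac1{k_0}$: $$\mathbb{P}^x\Big(\sup_{s\le t}\|X_s-x\|\le R\Big)\le\frac{C_2}{t}R^{1/b}.$$ The same estimates hold for $\mathbb{P}^x(T\ge t)$, where $T=T^x_R:=\inf\{t>0:\|X_t-x\|>R\}$.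
   Context: $\|\cdot\|$ is the Euclidean norm on $\mathbb{R}^d$ and also the induced operator norm on $d\times d$ matrices; $\langle\cdot,\cdot\rangle$ is the Euclidean scalar product; $\mathbb{S}^{d-1}$ is the Euclidean unit sphere. For $r>0$ and a matrix $A$, $r^A:=\exp(A\ln r)$. $\lambda(x)$ and $\Lambda(x)$ denote the minimum and the maximum of the real parts of the eigenvalues of $E(x)$. Bounded admissible exponent: a map $E:\mathbb{R}^d\to GL(\mathbb{R}^d)$ such that (E1) $E(x)$ is symmetric for every $x$; (E2) there is a constant $C>0$ with $\|E(y)-E(x)\|\le C\|y-x\|$ for all $x,y$; (E3) there is a constant $a>1/2$ with $a\le\lambda(x)$ for all $x$; (E4) there is a constant $b\ge a$ with $\Lambda(x)\le b<\infty$ for all $x$. Operator-stable-like Lévy measure: $\phi_x(A)=\int_{\mathbb{S}^{d-1}}\int_0^\infty1_A(r^{E(x)}\theta)\frac{dr}{r^2}\sigma(d\theta)$ for Borel $A\subset\mathbb{R}^d\setminus\{0\}$, where $\sigma$ is a finite measure on $\mathbb{S}^{d-1}$; here $\sigma$ is assumed symmetric, $\sigma(A)=\sigma(-A)$. OSL process: a (conservative) Itô process $(X,\mathbb{P}^x)_{x\in\mathbb{R}^d}$ with symbol $q(x,\xi)=\int_{\mathbb{R}^d\setminus\{0\}}(1-\cos\langle y,\xi\rangle)\,\phi_x(dy)$. That is: $X$ is a càdlàg universal Markov process ($\mathbb{P}^x(X_0=x)=1$, $x\mapsto\mathbb{P}^x(A)$ measurable, simple Markov property $\mathbb{P}^x(X_{s+t}\in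 B\mid\mathcal{F}^X_s)=\mathbb{P}^{X_s}(X_t\in B)$) which under every $\mathbb{P}^x$ is a semimartingale with characteristics, relative to the truncation function $y1_{\{\|y\|<1\}}$, $B=0$, $C=0$, $\nu(ds,dy)=\phi_{X_s}(dy)\,ds$.
   Formalization: The finite symmetric measure σ on the sphere is assumed to be nonzero; for σ = 0 the process X is constant, both probabilities equal 1 for all t, and the estimates fail for large t. *)

(* Defs.v *)
From HB Require Import structures.
From mathcomp Require Import all_boot all_order all_algebra.
From mathcomp Require Import complex.
From mathcomp Require Import all_classical all_reals all_analysis.
From mathcomp Require Import measurable_realfun.

Set Implicit Arguments.
Unset Strict Implicit.
Unset Printing Implicit Defensive.

Import Order.TTheory GRing.Theory Num.Theory.
Import numFieldNormedType.Exports.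

Local Open Scope classical_set_scope.
Local Open Scope ring_scope.

(* R^d is the space of column vectors with its Borel sigma-algebra. *)
Section borel_colvec.
Variables (R : realType) (d : nat).

HB.instance Definition _ :=
  @isMeasurable.Build (sigma_display (@open 'cV[R]_d)) 'cV[R]_d
    <<s @open 'cV[R]_d >>
    (@sigma_algebra0 _ setT _) (@sigma_algebraC _ _)
    (@sigma_algebra_bigcup _ setT _).

End borel_colvec.

Section euclidean.
Context {R : realType} {d : nat}.
Implicit Types (v : 'cV[R]_d) (A : 'M[R]_d).

(* The norm that the library puts on matrices is the sup norm of the entries. *)
Definition enorm v : R := Num.sqrt (\sum_(i < d) v i 0 ^+ 2).

Definition opnorm A : R := sup [set enorm (A *m v) | v in [set v | enorm v <= 1]].

Definition usphere : set 'cV[R]_d := [set v | enorm v = 1].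

Definition expmx A : 'M[R]_d :=
  limn (series (fun k : nat => (k`!%:R)^-1 *: A ^+ k)).

Definition rpowmx (r : R) A : 'M[R]_d := expmx (ln r *: A).

Definition eigen_re A : set R :=
  [set complex.Re z | z in [set z : R[i] |
     eigenvalue (map_mx (real_complex R) A) z]].

Definition min_eigen_re A : R := inf (eigen_re A).
Definition max_eigen_re A : R := sup (eigen_re A).

Record bounded_admissible (E : 'cV[R]_d -> 'M[R]_d) (a b : R) : Prop := {
  ba_unit : forall x, E x \in unitmx;
  ba_sym : forall x, (E x)^T = E x;
  ba_lip : exists2 C : R, 0 < C &
    forall x y, opnorm (E y - E x) <= C * enorm (y - x);
  ba_a_gt : 2^-1 < a;
  ba_lower : forall x, a <= min_eigen_re (E x);
  ba_le : a <= b;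
  ba_upper : forall x, max_eigen_re (E x) <= b }.

(* Finite measures on the unit sphere are represented by finite Borel measures
   on R^d that are carried by the sphere. *)
Record symmetric_spherical (sigma : {finite_measure set 'cV[R]_d -> \bar R}) :
    Prop := {
  ss_carried : sigma (~` usphere) = 0%E;
  ss_sym : forall A : set 'cV[R]_d, measurable A -> sigma A = sigma [set - v | v in A] }.

(* The set {0} is phi-null because the matrices r^(E x) are invertible, so phi
   may be read as a measure on the whole of R^d. *)
Definition osl_levy (E : 'cV[R]_d -> 'M[R]_d)
    (sigma : {finite_measure set 'cV[R]_d -> \bar R})
    (x : 'cV[R]_d) (A : set 'cV[R]_d) : \bar R :=
  (\int[sigma]_(theta in usphere)
     \int[lebesgue_measure]_(r in `]0%R, +oo[)
       (\1_A (rpowmx r (E x) *m theta) / r ^+ 2)%:E)%E.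

End euclidean.

(* Time is R; only the values of a process at times t >= 0 matter. *)
Section processes.
Context {R : realType} {dO : measure_display} {Om : measurableType dO}.
Implicit Types (F : R -> set (set Om)) (P : probability Om R)
  (M N : R -> Om -> R) (tau : Om -> \bar R).

Definition adapted {d} {S : measurableType d} F (X : R -> Om -> S) : Prop :=
  forall t : R, 0 <= t -> forall B, measurable B -> F t (X t @^-1` B).

Definition natural_filtration {d} {S : measurableType d} (X : R -> Om -> S)
    (t : R) : set (set Om) :=
  <<s [set A | exists (s : R) B, [/\ 0 <= s, s <= t, measurable B &
                              A = X s @^-1` B]] >>.

Definition cadlag {S : ptopologicalType} (f : R -> S) : Prop :=
  (forall t : R, 0 <= t -> f s @[s --> t^'+] --> f t) /\
  (forall t : R, 0 < t -> cvg (f s @[s --> t^'-])).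

Definition left_continuous {S : ptopologicalType} (f : R -> S) : Prop :=
  forall t : R, 0 < t -> f s @[s --> t^'-] --> f t.

Definition stopping_time F tau : Prop :=
  (forall w, 0 <= tau w)%E /\
  (forall t : R, 0 <= t -> F t [set w | tau w <= t%:E]%E).

Definition stopped M tau : R -> Om -> R :=
  fun t w => M (fine (mine t%:E (tau w))) w.

(* The last clause is E[M_t | F_s] = M_s. *)
Definition martingale P F M : Prop :=
  [/\ adapted F M,
      forall w, cadlag (M^~ w),
      forall t : R, 0 <= t -> P.-integrable setT (EFin \o M t) &
      forall (s t : R) A, 0 <= s -> s <= t -> F s A ->
        (\int[P]_(w in A) (M t w)%:E = \int[P]_(w in A) (M s w)%:E)%E].

Definition local_martingale P F M : Prop :=
  [/\ adapted F M,
      forall w, cadlag (M^~ w) &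
      exists tau : nat -> Om -> \bar R,
        [/\ forall n, stopping_time F (tau n),
            forall n w, (tau n w <= tau n.+1 w)%E,
            {ae P, forall w, tau ^~ w @ \oo --> +oo%E} &
            forall n, martingale P F (stopped M (tau n))]].

Definition continuous_local_martingale P F M : Prop :=
  local_martingale P F M /\
  (forall w, {within `[0, +oo[, continuous (M^~ w)}).

Definition purely_discontinuous P F M : Prop :=
  [/\ local_martingale P F M,
      {ae P, forall w, M 0 w = 0} &
      forall N, continuous_local_martingale P F N ->
        local_martingale P F (fun t w => M t w * N t w)].

(* The predictable sigma-algebra on Om x [0, +oo[ is generated by the
   left-continuous adapted processes. Here it lives on Om x R, where
   Om x ]-oo, 0[ is a single atom. *)
Definition predictable_gen F : set (set (Om * R)) :=
  [set A | exists (Y : R -> Om -> R) (B : set R),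
     [/\ adapted F Y, forall w, left_continuous (Y^~ w), measurable B &
         A = [set z | 0 <= z.2 /\ B (Y z.2 z.1)]]].

Definition predictable F (Y : R -> Om -> \bar R) : Prop :=
  @measurable_fun _ _ (g_sigma_algebraType (predictable_gen F)) (\bar R)
    [set z | 0 <= z.2] (fun z => Y z.2 z.1).

Definition predictable_fun {d} {S : measurableType d} F
    (W : Om -> R -> S -> \bar R) : Prop :=
  @measurable_fun _ _ (g_sigma_algebraType (predictable_gen F) * S)%type (\bar R)
    [set z | 0 <= z.1.2] (fun z => W z.1.1 z.1.2 z.2).

Definition predictable_fv F (A : R -> Om -> R) : Prop :=
  [/\ predictable F (fun t w => (A t w)%:E),
      forall w, cadlag (A^~ w),
      forall w, A 0 w = 0 &
      forall w (t : R), 0 <= t -> bounded_variation 0 t (A^~ w)].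

End processes.

Section characteristics.
Context {R : realType} {d : nat} {dO : measure_display} {Om : measurableType dO}.
Implicit Types (F : R -> set (set Om)) (P : probability Om R)
  (X B : R -> Om -> 'cV[R]_d) (C : R -> Om -> 'M[R]_d)
  (nu : Om -> set (R * 'cV[R]_d) -> \bar R).

Definition trunc (y : 'cV[R]_d) : 'cV[R]_d := if enorm y < 1 then y else 0.

Definition jump X (s : R) (w : Om) : 'cV[R]_d :=
  X s w - lim (X u w @[u --> s^'-]).

(* For a cadlag path only finitely many terms of this sum are nonzero. *)
Definition big_jumps X (t : R) (w : Om) : 'cV[R]_d :=
  \sum_(s \in (`]0, t] : set R)) (jump X s w - trunc (jump X s w)).

(* The process t |-> (W * nu)_t. *)
Definition star_meas nu (W : Om -> R -> 'cV[R]_d -> \bar R) (t : R) (w : Om) :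
    \bar R :=
  (\int[nu w]_(z in `[0%R, t] `*` setT) W w z.1 z.2)%E.

Definition star_meas_oo nu (W : Om -> R -> 'cV[R]_d -> \bar R) (w : Om) :
    \bar R :=
  (\int[nu w]_(z in `[0%R, +oo[ `*` setT) W w z.1 z.2)%E.

(* (W * mu)_oo for the jump measure mu of X. *)
Definition star_jumps_oo X (W : Om -> R -> 'cV[R]_d -> \bar R) (w : Om) :
    \bar R :=
  (\esum_(s in [set s : R | (0 < s)%R /\ jump X s w != 0%R]) W w s (jump X s w))%E.

(* nu is the predictable compensator of the jump measure of X. *)
Definition compensator P F X nu : Prop :=
  forall W : Om -> R -> 'cV[R]_d -> \bar R,
    predictable_fun F W -> (forall w s y, 0 <= W w s y)%E ->
    predictable F (star_meas nu W) /\
    (\int[P]_w star_jumps_oo X W w = \int[P]_w star_meas_oo nu W w)%E.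

(* X is a semimartingale with characteristics (B, C, nu) relative to trunc:
   the canonical decomposition is X = X_0 + Mc + Md + big_jumps X + B with
   continuous martingale part Mc, and C = <Mc, Mc>. *)
Definition has_characteristics P F X B C nu : Prop :=
  [/\ adapted F X,
      forall w, cadlag (X^~ w),
      forall i, predictable_fv F (fun t w => B t w i 0),
      exists Mc Md : R -> Om -> 'cV[R]_d,
        [/\ forall i, continuous_local_martingale P F (fun t w => Mc t w i 0) /\
              {ae P, forall w, Mc 0 w i 0 = 0},
            forall i, purely_discontinuous P F (fun t w => Md t w i 0),
            {ae P, forall w, forall t : R, 0 <= t ->
               X t w - big_jumps X t w = X 0 w + Mc t w + Md t w + B t w} &
            forall i j,
              [/\ predictable_fv F (fun t w => C t w i j),
                  forall w, {within `[0, +oo[, continuous (fun t : R => C t w i j)} &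
                  local_martingale P F
                    (fun t w => Mc t w i 0 * Mc t w j 0 - C t w i j)]] &
      compensator P F X nu].

(* nu(w; ds, dy) = phi_(X_s w)(dy) ds *)
Definition osl_nu (E : 'cV[R]_d -> 'M[R]_d)
    (sigma : {finite_measure set 'cV[R]_d -> \bar R}) X (w : Om)
    (D : set (R * 'cV[R]_d)) : \bar R :=
  (\int[lebesgue_measure]_(s in `[0%R, +oo[)
     osl_levy E sigma (X s w) (xsection D s))%E.

Record osl_process (E : 'cV[R]_d -> 'M[R]_d)
    (sigma : {finite_measure set 'cV[R]_d -> \bar R})
    (P : 'cV[R]_d -> probability Om R) X : Prop := {
  osl_meas : forall t : R, 0 <= t -> measurable_fun setT (X t);
  osl_cadlag : forall w, cadlag (X^~ w);
  osl_start : forall x, P x [set w | X 0 w = x] = 1%E;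
  osl_kernel : forall A : set Om, measurable A ->
    measurable_fun setT (fun x => P x A);
  (* P^x(X_(s+t) in B | F^X_s) = P^(X_s)(X_t in B) *)
  osl_markov : forall x (s t : R) (A : set Om) (B : set 'cV[R]_d), 0 <= s -> 0 <= t ->
    natural_filtration X s A -> measurable B ->
    (P x (A `&` X (s + t)%R @^-1` B) =
     \int[P x]_(w in A) P (X s w) (X t @^-1` B))%E;
  osl_char : forall x, has_characteristics (P x) (natural_filtration X) X
    (fun _ _ => 0) (fun _ _ => 0) (osl_nu E sigma X) }.

(* sup_(s <= t) |X_s - x| *)
Definition sup_dist X (x : 'cV[R]_d) (t : R) (w : Om) : \bar R :=
  ereal_sup [set (enorm (X s w - x))%:E | s in `[0, t]].

(* T^x_r = inf {t > 0 : |X_t - x| > r}, equal to +oo if the set is empty *)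
Definition exit_time X (x : 'cV[R]_d) (r : R) (w : Om) : \bar R :=
  ereal_inf [set t%:E | t in [set t : R | 0 < t /\ r < enorm (X t w - x)]].

End characteristics.

(* Main.v *)
Require Import Defs.
From mathcomp Require Import all_boot all_order all_algebra.
From mathcomp Require Import all_classical all_reals all_analysis.
From mathcomp Require Import complex measurable_realfun.
From mathcomp Require Import lra ring.

Import Order.TTheory GRing.Theory Num.Theory.
Import numFieldNormedType.Exports.

Local Open Scope classical_set_scope.
Local Open Scope ring_scope.

(** Large jumps alone force the process out of the ball, and they are counted by
    the compensator of the jump measure.

    Let T be the exit time of X from the closed ball of radius r around x. A
    path lies in that ball before T, left limits included, so no jump before T
    is longer than 2 r; hence at most one jump of length greater than 2 r occurs
    up to T, namely the one at T itself (lemma exit_time_big_jump). On the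
    other hand jumps longer than 2 r occur at the rate phi_(X_s)(|y| > 2 r).
    The set of the (w, s) with s <= min(t, T w) is predictable, so the
    compensator formula, applied to the number of jumps longer than 2 r up to
    min(t, T), gives
      E^x[min(t, T)] * inf_y phi_y(|v| > 2 r) <= 1,
    and therefore t * P^x(T >= t) * inf_y phi_y(|v| > 2 r) <= 1. This is lemma
    exit_time_tail. If sup_(s <= t) |X_s - x| <= r then T >= t, so the other
    probability is smaller.

    The jump rate is bounded below as follows (lemma osl_levy_tail_ge). As E(y)
    is symmetric with spectrum in [a, b], |rho^(E y) theta| is at least
    min(rho^a, rho^b) for every unit vector theta (lemma rpowmx_enorm_ge). If
    2 r <= min(m^a, m^b), every rho > m thus contributes to phi_y(|v| > 2 r), in
    particular every rho in ]m, 2 m], where 1 / rho^2 >= 1 / (4 m^2): the rate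
    is at least sigma(S) / (4 m). So P^x(T >= t) <= 4 m / (t sigma(S)).

    What remains is to take m = K r^(1/a) when r is bounded away from 0, and
    m = K r^(1/b) when r is bounded; a large enough constant K makes
    2 r <= min(m^a, m^b) on each of these ranges (lemma exists_powR_scale). *)

(** * Integrals of possibly non-measurable functions *)

Section integral_bounds.
Import HBNNSimple.

Lemma sintegral_scale_indic {d} {T : measurableType d} {R : realType}
    (mu : set T -> \bar R) (A : set T) (c : R) : mu set0 = 0%E ->
  sintegral mu (fun x => c * \1_A x) = (c%:E * mu A)%E.
Proof.
move=> mu0; rewrite /sintegral -(fsbig_widen [set c] setT) //=; last first.
  move=> x [_ /= xc]; have [->|x0] := eqVneq x 0; first by rewrite mul0e.
  rewrite (_ : _ @^-1` _ = set0) ?mu0 ?mule0 //.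
  rewrite -subset0 => y /=; rewrite indicE; case: (_ \in _) => /=.
    by rewrite mulr1 => /esym.
  by rewrite mulr0 => /esym /eqP; rewrite (negPf x0).
rewrite fsbig_set1; have [->|c0] := eqVneq c 0; first by rewrite !mul0e.
congr (_ * mu _)%E; apply/seteqP; split => y /=.
  rewrite indicE; have [/set_mem//|_] := boolP (y \in A).
  by rewrite mulr0 => /esym /eqP; rewrite (negPf c0).
by move=> Ay; rewrite indicE mem_set // mulr1.
Qed.

(** The integral is a supremum over simple functions below f, so c times the
    indicator of A is a competitor even if f is not measurable and mu is not
    known to be a measure: osl_nu is used as a mere set function, and the
    lower bounds on osl_levy and osl_nu hold for arbitrary integrands. *)
Lemma integral_ge_cst {d} {T : measurableType d} {R : realType}
    (mu : set T -> \bar R) (D A : set T) (f : T -> \bar R) (c : R) :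
  mu set0 = 0%E -> measurable A -> A `<=` D -> 0 <= c ->
  (forall x, D x -> (0 <= f x)%E) -> (forall x, A x -> (c%:E <= f x)%E) ->
  (c%:E * mu A <= \int[mu]_(x in D) f x)%E.
Proof.
move=> mu0 mA AD c0 f0 cf; rewrite /integral funeneg_restrict funepos_restrict.
have /eq_restrictP-> := ge0_funeposE f0.
have /eq_restrictP-> := ge0_funenegE f0.
rewrite erestrict0 [X in (_ - X)%E](_ : _ = 0%E); last first.
  rewrite -[RHS]ereal_sup1; congr ereal_sup.
  have s0 : sintegral mu (cst 0) = 0%E.
    have := sintegral_scale_indic mu setT 0 mu0; rewrite mul0e => <-.
    by congr sintegral; apply/funext => x; rewrite mul0r.
  apply/seteqP; split => [_ [h /= h0 <-]|_ ->] /=.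
    rewrite -s0; congr sintegral; apply/funext => x.
    by apply/eqP; rewrite eq_le -!lee_fin h0 lee_fin /=.
  by exists nnsfun0.
rewrite sube0; apply: ereal_sup_ubound.
exists (scale_nnsfun (indic_nnsfun R mA) c0); last first.
  exact: sintegral_scale_indic.
move=> x /=; rewrite patchE.
have [xA|xA] := boolP (x \in A).
  rewrite mindicE xA mulr1 mem_set; last by apply: AD; exact: set_mem.
  by apply: cf; exact: set_mem.
rewrite mindicE (negPf xA) mulr0; case: ifPn => // /set_mem; exact: f0.
Qed.

Lemma integral_raw_ge0 {d} {T : measurableType d} {R : realType}
    (mu : set T -> \bar R) (D : set T) (f : T -> \bar R) :
  mu set0 = 0%E -> (forall x, D x -> (0 <= f x)%E) ->
  (0 <= \int[mu]_(x in D) f x)%E.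
Proof.
move=> mu0 f0; rewrite -[leLHS](mul0e (mu set0)).
by apply: integral_ge_cst => //; exact: sub0set.
Qed.

(** Every simple function below f is at most 1, so f need not be measurable; it
    will be the number of large jumps of a path up to its exit time. *)
Lemma integral_le1 {d} {T : measurableType d} {R : realType}
    (mu : probability T R) (f : T -> \bar R) :
  (forall x, (0 <= f x)%E) -> (forall x, (f x <= 1)%E) ->
  (\int[mu]_x f x <= 1)%E.
Proof.
move=> f0 f1; rewrite ge0_integralE //; apply/ge_ereal_sup => _ [h /= hf <-].
rewrite -integralT_nnsfun -(@probability_setT _ _ _ mu).
rewrite -(mul1e (mu setT)) -(integral_cst mu (@measurableT _ T)).
apply: ge0_le_integral => //.
- by move=> x _; rewrite lee_fin.
- exact/measurable_EFinP.
- by move=> x _; apply: le_trans (hf x) _; rewrite patch_setT.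
Qed.

End integral_bounds.

(** * Exponentials of symmetric matrices *)

Lemma cvg_sum_fin {K : numFieldType} {V : normedModType K} {T : Type}
    {F : set_system T} {FF : Filter F} {I : finType} (f : I -> T -> V)
    (l : I -> V) :
  (forall i, f i x @[x --> F] --> l i) ->
  \sum_i f i x @[x --> F] --> \sum_i l i.
Proof. by move=> fl; apply: cvg_big => //; exact: add_continuous. Qed.

Lemma mulmx_conj_exp {K : comUnitRingType} {n} (P : 'M[K]_n) (D : 'rV[K]_n) k :
  P \in unitmx ->
  (invmx P *m diag_mx D *m P) ^+ k =
    invmx P *m diag_mx (\row_i D 0 i ^+ k) *m P.
Proof.
move=> uP; elim: k => [|k IH].
  rewrite expr0 (_ : diag_mx _ = 1%:M) ?mulmx1 ?mulVmx //.
  by apply/matrixP => i j; rewrite !mxE expr0.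
rewrite exprS IH -[_ * _]/(_ *m _) !mulmxA mulmxK //; congr (_ *m _).
rewrite -mulmxA; congr (_ *m _); apply/matrixP => i j.
by rewrite mul_diag_mx !mxE exprS mulrnAr.
Qed.

(** The complexification of A is hermitian, hence unitarily diagonalizable with
    a real diagonal s. If p is the i-th row of the unitary matrix, c i is the
    real part of p^* p, that is (Re p)^T (Re p) + (Im p)^T (Im p): this is
    positive semidefinite, and taking real parts keeps the expansion of the
    powers of A because the s i are real. *)
Lemma spectral_real {R : realType} {d} (A : 'M[R]_d) : A^T = A ->
  exists (s : 'I_d -> R) (c : 'I_d -> 'M[R]_d),
    [/\ forall k, A ^+ k = \sum_i s i ^+ k *: c i,
        forall i (v : 'cV[R]_d), 0 <= (v^T *m c i *m v) 0 0,
        forall i, eigen_re A (s i) &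
        forall z, eigen_re A z -> exists i, z = s i].
Proof.
move=> symA; pose M := map_mx (real_complex R) A.
have realM : M \is a mxOver Num.real.
  by apply/mxOverP => i j; rewrite mxE complex_real.
have symM : M \is symmetricmx.
  apply/is_hermitianmxP; rewrite expr0 scale1r map_mx_id //.
  by rewrite /M map_trmx symA.
have herM : M \is hermsymmx by exact: realsym_hermsym.
have /orthomx_spectralP defM := hermitian_normalmx herM.
have realS := hermitian_spectral_diag_real herM.
have uP := spectral_unit M.
have P_inv := invmx_unitary (spectral_unitarymx M).
set P := spectralmx M in defM uP P_inv *.
set S := spectral_diag M in defM realS.
have SE i : S 0 i = (complex.Re (S 0 i))%:C%C.
  by rewrite RRe_real //; exact: (mxOverP realS).
pose x i := map_mx (@complex.Re R) (row i P).
pose y i := map_mx (@complex.Im R) (row i P).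
exists (fun i => complex.Re (S 0 i)),
  (fun i => (x i)^T *m x i + (y i)^T *m y i).
split.
- move=> k; apply/matrixP => a b.
  have : ((A ^+ k) a b)%:C%C = (M ^+ k) a b.
    have -> : M ^+ k = map_mx (real_complex R) (A ^+ k).
      elim: k => [|k IH]; first by rewrite !expr0 map_mx1.
      by rewrite !exprS IH -[_ * _]/(_ *m _) -map_mxM.
    by rewrite mxE.
  rewrite defM mulmx_conj_exp // P_inv -mulmxA mul_diag_mx mxE.
  move/(congr1 (@complex.Re R)) => /= ->.
  rewrite (big_morph (@complex.Re R) (id1 := 0) (op1 := +%R)) //;
    last by case=> ? ? [].
  rewrite summxE; apply: eq_bigr => i _; rewrite !mxE !big_ord1 !mxE.
  rewrite (SE i) -rmorphXn /=.
  case: (P i a) => p q; case: (P i b) => u v /=.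
  by simpc => /=; ring.
- move=> i v; rewrite mulmxDr mulmxDl !mulmxA mxE.
  have sq (u : 'rV[R]_d) : 0 <= (v^T *m u^T *m u *m v) 0 0.
    rewrite -trmx_mul -mulmxA mxE big_ord1 [X in X * _]mxE -expr2.
    exact: sqr_ge0.
  by rewrite addr_ge0.
- move=> i; exists (S 0 i) => //=; apply/eigenvalueP; exists (row i P).
    rewrite -/M defM -row_mul !mulmxA mulmxV // mul1mx row_mul.
    by rewrite row_diag_mx -scalemxAl -rowE.
  apply/eqP => Pi0; have : row i (P *m invmx P) = 0.
    by rewrite row_mul Pi0 mul0mx.
  rewrite mulmxV // => /matrixP /(_ 0 i) /eqP.
  by rewrite !mxE eqxx oner_eq0.
- move=> _ [z /eigenvalueP [v vM v0] <-].
  pose u := v *m invmx P.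
  have u0 : u != 0.
    by apply: contraNneq v0 => u0; rewrite -(mulmxKV uP v) -/u u0 mul0mx.
  have uS : u *m diag_mx S = z *: u.
    by rewrite /u scalemxAl -vM -/M defM !mulmxA mulmxK.
  have /rV0Pn [i ui] := u0; exists i; congr complex.Re.
  move/matrixP: uS => /(_ 0 i); rewrite mul_mx_diag [LHS]mxE [RHS]mxE => e.
  by apply: (mulIf ui); rewrite -e mulrC.
Qed.

(** The infimum and the supremum that define the extreme eigenvalues are
    meaningful because the spectrum is among the finitely many s i. *)
Lemma eigen_re_bounds {R : realType} {d} (A : 'M[R]_d) (a b : R) :
  A^T = A -> a <= min_eigen_re A -> max_eigen_re A <= b ->
  forall z, eigen_re A z -> a <= z <= b.
Proof.
move=> symA aA Ab z Az; have [s [_ [_ _ _ onlyS]]] := spectral_real A symA.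
have bnd y : eigen_re A y -> `|y| <= \sum_i `|s i|.
  move=> /onlyS [i ->]; rewrite (bigD1 i) //= lerDl.
  exact: sumr_ge0.
apply/andP; split.
  apply: (le_trans aA); apply: ge_inf => //.
  by exists (- \sum_i `|s i|) => y /bnd; rewrite ler_norml => /andP[].
apply: le_trans Ab; apply: ub_le_sup => //.
by exists (\sum_i `|s i|) => y /bnd; rewrite ler_norml => /andP[].
Qed.

Lemma enorm_sqr {R : realType} {d} (v : 'cV[R]_d) :
  enorm v ^+ 2 = \sum_i v i 0 ^+ 2.
Proof. by rewrite sqr_sqrtr // sumr_ge0 // => i _; exact: sqr_ge0. Qed.

Lemma continuous_enorm {R : realType} {d} :
  continuous (@enorm R d).
Proof.
move=> v; apply: (@continuous_cvg _ _ _ (nbhs v) _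
  (fun w : 'cV[R]_d => \sum_i w i 0 ^+ 2) Num.sqrt).
  exact: sqrt_continuous.
apply: (@cvg_sum_fin _ _ _ (nbhs v)) => i.
by apply: cvgM; exact: coord_continuous.
Qed.

(** For symmetric A the scalar product of A^j v and A^k v is v^T A^(j+k) v, so
    the square of a polynomial in A again expands along the c i, with the
    square of the polynomial as coefficient. The matrices c i need not be
    projections, which is why powers of A are used rather than c i *m c j. *)
Lemma enorm_sqr_poly {R : realType} {d} (A : 'M[R]_d) (s : 'I_d -> R)
    (c : 'I_d -> 'M[R]_d) (p : nat -> R) n (v : 'cV[R]_d) :
  A^T = A -> (forall k, A ^+ k = \sum_i s i ^+ k *: c i) ->
  enorm ((\sum_(0 <= k < n) p k *: A ^+ k) *m v) ^+ 2 =
  \sum_i (\sum_(0 <= k < n) p k * s i ^+ k) ^+ 2 * (v^T *m c i *m v) 0 0.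
Proof.
move=> symA powA.
have symX k : (A ^+ k)^T = A ^+ k.
  elim: k => [|k IH]; first by rewrite expr0 trmx1.
  rewrite exprS -[_ * _]/(_ *m _) trmx_mul IH symA -[LHS]/(_ * _).
  by rewrite -exprSr exprS.
have -> (w : 'cV[R]_d) : enorm w ^+ 2 = (w^T *m w) 0 0.
  by rewrite enorm_sqr mxE; apply: eq_bigr => i _; rewrite mxE expr2.
rewrite !mulmx_suml [X in X *m _]raddf_sum mulmx_suml summxE.
transitivity (\sum_(0 <= j < n) \sum_(0 <= k < n) \sum_i
    (p j * s i ^+ j) * (p k * s i ^+ k) * (v^T *m c i *m v) 0 0).
  apply: eq_bigr => j _; rewrite mulmx_sumr summxE; apply: eq_bigr => k _.
  rewrite -!scalemxAl -scalemxAr /= linearZ /= -scalemxAl trmx_mul symX.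
  rewrite mulmxA -[v^T *m _ *m _]mulmxA.
  rewrite -[A ^+ j *m _]/(A ^+ j * _) -exprD powA mulmx_sumr mulmx_suml.
  rewrite !mxE summxE !mulr_sumr; apply: eq_bigr => i _.
  by rewrite -scalemxAr -scalemxAl mxE exprD; ring.
under eq_bigr do rewrite exchange_big /=.
rewrite exchange_big /=; apply: eq_bigr => i _.
rewrite expr2 !mulr_suml; apply: eq_bigr => j _.
by rewrite mulr_sumr mulr_suml.
Qed.

(** Along the spectral expansion the exponential series of A becomes finitely
    many real exponential series, so the limit that defines expmx exists. *)
Lemma cvg_expmx {R : realType} {d} (A : 'M[R]_d) (s : 'I_d -> R)
    (c : 'I_d -> 'M[R]_d) :
  (forall k, A ^+ k = \sum_i s i ^+ k *: c i) ->
  series (fun k : nat => (k`!%:R)^-1 *: A ^+ k) @ \oo --> expmx A.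
Proof.
move=> powA; suff h : series (fun k : nat => (k`!%:R)^-1 *: A ^+ k) @ \oo -->
    \sum_i expR (s i) *: c i by apply/cvg_ex; eexists; exact: h.
rewrite (_ : series _ = fun n =>
    \sum_i series (exp_coeff (s i)) n *: c i); last first.
  apply/funext => n; rewrite /series /=.
  under [RHS]eq_bigr do rewrite scaler_suml.
  rewrite exchange_big /=; apply: eq_bigr => k _.
  rewrite powA scaler_sumr; apply: eq_bigr => i _.
  by rewrite scalerA mulrC.
apply: cvg_sum_fin => i; apply: cvgZr_tmp; exact: is_cvg_series_exp_coeff.
Qed.

(** In the limit of enorm_sqr_poly, |exp(t A) v|^2 is the sum of the
    exp(t s_i)^2 q_i, and |v|^2 that of the q_i, where q_i = v^T c_i v >= 0. *)
Lemma enorm_expmx_ge {R : realType} {d} (A : 'M[R]_d) (t m : R)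
    (v : 'cV[R]_d) :
  A^T = A -> 0 <= m -> (forall z, eigen_re A z -> m <= expR (t * z)) ->
  m * enorm v <= enorm (expmx (t *: A) *m v).
Proof.
move=> symA m0 mA.
suff [s [c [powA c0 sA]]] : exists (s : 'I_d -> R) (c : 'I_d -> 'M[R]_d),
    [/\ forall k, (t *: A) ^+ k = \sum_i s i ^+ k *: c i,
        forall i (v : 'cV[R]_d), 0 <= (v^T *m c i *m v) 0 0 &
        forall i, m <= expR (s i)]; last first.
  have [s [c [powA c0 sA _]]] := spectral_real A symA.
  exists (fun i => t * s i), c; split => // [k|i]; last exact: mA.
  have -> : (t *: A) ^+ k = t ^+ k *: A ^+ k.
    elim: k => [|k IH]; first by rewrite !expr0 scale1r.
    rewrite !exprS IH -[LHS]/((t *: A) *m (t ^+ k *: A ^+ k)).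
    by rewrite -scalemxAl -scalemxAr scalerA.
  rewrite powA scaler_sumr; apply: eq_bigr => i _.
  by rewrite scalerA exprMn.
(* From here on the matrix t *: A is the symmetric matrix under study. *)
have {}symA : (t *: A)^T = t *: A by rewrite linearZ /= symA.
move: (t *: A) symA powA => {mA}A symA powA.
have expE : enorm (expmx A *m v) ^+ 2 =
    \sum_i expR (s i) ^+ 2 * (v^T *m c i *m v) 0 0.
  pose S n : 'M[R]_d := series (fun k : nat => (k`!%:R)^-1 *: A ^+ k) n.
  have Sv : enorm (S n *m v) ^+ 2 @[n --> \oo] --> enorm (expmx A *m v) ^+ 2.
    have cont : continuous (fun B : 'M[R]_d => enorm (B *m v) ^+ 2).
      move=> B; under eq_fun do rewrite enorm_sqr.
      apply: (@cvg_sum_fin _ _ _ (nbhs B)) => i; apply: cvgM.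
        rewrite mxE; under eq_fun do rewrite mxE.
        apply: (@cvg_sum_fin _ _ _ (nbhs B)) => j.
        by apply: cvgMl; exact: coord_continuous.
      rewrite mxE; under eq_fun do rewrite mxE.
      apply: (@cvg_sum_fin _ _ _ (nbhs B)) => j.
        by apply: cvgMl; exact: coord_continuous.
    exact: (continuous_cvg _ (cont _) (cvg_expmx _ _ _ powA)).
  have e i : (fun n => \sum_(0 <= k < n) (k`!%:R)^-1 * s i ^+ k) @ \oo -->
      expR (s i).
    rewrite (_ : (fun n => _) = series (exp_coeff (s i))).
      exact: is_cvg_series_exp_coeff.
    by apply/funext => n; apply: eq_bigr => k _; rewrite mulrC.
  suff Sv' : enorm (S n *m v) ^+ 2 @[n --> \oo] -->
      \sum_i expR (s i) ^+ 2 * (v^T *m c i *m v) 0 0.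
    exact: cvg_unique Sv Sv'.
  rewrite (_ : (fun n => enorm _ ^+ 2) = fun n =>
      \sum_i (\sum_(0 <= k < n) (k`!%:R)^-1 * s i ^+ k) ^+ 2 *
        (v^T *m c i *m v) 0 0).
    by apply: cvg_sum_fin => i; apply: cvgMl; exact: cvgM (e i) (e i).
  apply/funext => n.
  exact: (enorm_sqr_poly A s c (fun k => (k`!%:R)^-1) n v symA powA).
have vE : enorm v ^+ 2 = \sum_i (v^T *m c i *m v) 0 0.
  have := enorm_sqr_poly A s c (fun=> 1) 1 v symA powA.
  rewrite big_nat1 scale1r expr0 mul1mx => ->; apply: eq_bigr => i _.
  by rewrite big_nat1 expr0 mulr1 expr1n mul1r.
rewrite -(@ler_pXn2r _ 2) // ?nnegrE ?mulr_ge0 ?sqrtr_ge0 //.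
rewrite exprMn expE vE mulr_sumr; apply: ler_sum => i _.
by rewrite ler_wpM2r // ler_pXn2r // ?nnegrE ?expR_ge0.
Qed.

(** * The tail of the operator-stable-like measure *)

Lemma measurable_open {R : realType} {d} (U : set 'cV[R]_d) :
  open U -> measurable U.
Proof. exact: sub_sigma_algebra. Qed.

Lemma continuous_edist {R : realType} {d} (x : 'cV[R]_d) :
  continuous (fun y : 'cV[R]_d => enorm (y - x)).
Proof.
move=> y; apply: (@continuous_cvg _ _ _ (nbhs y) _
  (fun z : 'cV[R]_d => z - x) enorm).
  exact: continuous_enorm.
by apply: (@cvgB _ _ _ (nbhs y)); [exact: cvg_id|exact: cvg_cst].
Qed.

Lemma measurable_enorm_gt {R : realType} {d} (x : 'cV[R]_d) (r : R) :
  measurable [set y | r < enorm (y - x)].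
Proof.
apply: measurable_open.
rewrite -[X in open X]/((fun y => enorm (y - x)) @^-1` [set t | r < t]).
apply: open_comp; last exact: open_gt.
by move=> y _; exact: continuous_edist.
Qed.

Lemma measurable_enorm_le {R : realType} {d} (x : 'cV[R]_d) (r : R) :
  measurable [set y | enorm (y - x) <= r].
Proof.
rewrite (_ : [set _ | _] = ~` [set y | r < enorm (y - x)]).
  by apply: measurableC; exact: measurable_enorm_gt.
by apply/seteqP; split => y /=; rewrite leNgt => /negP.
Qed.

Lemma measurable_usphere {R : realType} {d} : measurable (@usphere R d).
Proof.
rewrite -[usphere]setCK; apply: measurableC; apply: measurable_open.
have -> : ~` @usphere R d = enorm @^-1` [set t | t != 1].
  by apply/seteqP; split => y /= h; [apply/eqP; exact: h|exact: elimN eqP h].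
apply: open_comp; last exact: open_neq.
by move=> y _; exact: continuous_enorm.
Qed.

(** Which of the two powers is the smaller depends on the side of 1 on which r
    lies; the minimum spares the distinction. *)
Lemma powR_ge_min {R : realType} (a b z r : R) : 0 < r -> a <= z <= b ->
  Num.min (r `^ a) (r `^ b) <= r `^ z.
Proof.
move=> r0 /andP[az zb]; rewrite ge_min; case: (leP 1 r) => r1.
  by rewrite ler_powR.
by rewrite orbC ger_powR // r0 ltW.
Qed.

Lemma rpowmx_enorm_ge {R : realType} {d} (A : 'M[R]_d) (a b r : R)
    (v : 'cV[R]_d) :
  A^T = A -> a <= min_eigen_re A -> max_eigen_re A <= b -> 0 < r ->
  Num.min (r `^ a) (r `^ b) * enorm v <= enorm (rpowmx r A *m v).
Proof.
move=> symA aA Ab r0; apply: enorm_expmx_ge => //.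
  by rewrite le_min !powR_ge0.
move=> z /(eigen_re_bounds _ _ _ symA aA Ab) abz.
have -> : expR (ln r * z) = r `^ z by rewrite /powR gt_eqF // mulrC.
exact: powR_ge_min.
Qed.

(** Every radius above m moves the unit sphere beyond rho, and the radii in
    ]m, 2 m] alone have mass at least m / (2 m)^2 for dr / r^2. *)
Lemma osl_levy_tail_ge {R : realType} {d} (E : 'cV[R]_d -> 'M[R]_d) (a b : R)
    (sigma : {finite_measure set 'cV[R]_d -> \bar R}) (rho m : R)
    (x : 'cV[R]_d) :
  bounded_admissible E a b -> symmetric_spherical sigma ->
  0 < m -> rho <= m `^ a -> rho <= m `^ b ->
  ((4 * m)^-1%:E * sigma setT <=
    osl_levy E sigma x [set y | (rho < enorm y)%R])%E.
Proof.
move=> hE hs m0 ma mb; have a0 : 0 < a by apply: lt_trans (ba_a_gt hE).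
have b0 : 0 < b := lt_le_trans a0 (ba_le hE).
have -> : sigma setT = sigma usphere.
  rewrite -(setUv usphere) measureU //; last 3 first.
  - exact: measurable_usphere.
  - by apply: measurableC; exact: measurable_usphere.
  - exact: setICr.
  by rewrite [X in (_ + X)%E](ss_carried hs : sigma (~` usphere) = 0%E) adde0.
have int0 (y : 'cV[R]_d) (B : set 'cV[R]_d) (r : R) :
    (0 <= (\1_B y / r ^+ 2)%:E)%E.
  by rewrite lee_fin divr_ge0 // sqr_ge0.
apply: integral_ge_cst => //.
- exact: measurable_usphere.
- by rewrite invr_ge0 mulr_ge0 // ltW.
- move=> theta _; apply: integral_ge0 => r _; exact: int0.
move=> theta theta1.
have -> : (4 * m)^-1%:E =
    (((m + m) ^+ 2)^-1%:E * (lebesgue_measure `]m, (m + m)%R]%classic))%E.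
  rewrite lebesgue_measure_itv /= lte_fin ltrDl m0 -EFinD -EFinM addrK.
  by congr EFin; field; rewrite !gt_eqF ?addr_gt0.
apply: integral_ge_cst => //.
- by move=> r /=; rewrite !in_itv /= andbT => /andP[mr _]; exact: lt_trans mr.
- by rewrite invr_ge0 sqr_ge0.
move=> r /=; rewrite in_itv /= => /andP[mr r2].
have r0 := lt_trans m0 mr.
rewrite lee_fin indicE mem_set /=.
  rewrite mul1r lef_pV2 ?posrE ?exprn_gt0 ?addr_gt0 //.
  by rewrite ler_pXn2r // nnegrE ltW // addr_gt0.
apply: lt_le_trans (rpowmx_enorm_ge _ _ _ _ _ (ba_sym hE x)
  (ba_lower hE x) (ba_upper hE x) r0).
rewrite theta1 mulr1 lt_min.
by rewrite (le_lt_trans ma) ?(le_lt_trans mb) // gt0_ltr_powR // nnegrE ltW.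
Qed.

(** With m = K r^(1/p), m^p = K^p r is at least 2 r as soon as K^p >= 2, while
    m^q = K^q r r^(q/p - 1), whose last factor is bounded below by hypothesis.
    The hypothesis amounts to r >= k if p < q and to r <= k if q < p, so one
    lemma serves both large and small radii. *)
Lemma exists_powR_scale {R : realType} (p q k : R) : 0 < p -> 0 < q -> 0 < k ->
  exists2 K : R, 0 < K & forall r, 0 < r ->
    k `^ (q / p - 1) <= r `^ (q / p - 1) ->
    2 * r <= (K * r `^ p^-1) `^ p /\ 2 * r <= (K * r `^ p^-1) `^ q.
Proof.
move=> p0 q0 k0; set e := q / p - 1.
have ke := powR_gt0 e k0.
pose K1 : R := 2 `^ p^-1; pose K2 : R := (2 / k `^ e) `^ q^-1.
have K10 : 0 < K1 by exact: powR_gt0.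
have K20 : 0 < K2 by apply: powR_gt0; rewrite divr_gt0.
exists (K1 + K2) => [|r r0 kr]; first by rewrite addr_gt0.
have rp := powR_ge0 r p^-1.
have K1K : K1 <= K1 + K2 by rewrite lerDl ltW.
have K2K : K2 <= K1 + K2 by rewrite lerDr ltW.
have K0 := ltW (addr_gt0 K10 K20).
rewrite !powRM // -!powRrM mulVf ?gt_eqF // powRr1 ?(ltW r0) //; split.
  rewrite ler_pM2r //; have -> : 2 = K1 `^ p :> R.
    by rewrite -powRrM mulVf ?gt_eqF // powRr1.
  by rewrite ge0_ler_powR // ?nnegrE ltW.
have -> : p^-1 * q = 1 + e by rewrite /e; field; rewrite gt_eqF.
rewrite powRD; last by rewrite (gt_eqF r0) implybT.
rewrite powRr1 ?(ltW r0) // mulrCA mulrC ler_pM2l //.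
have -> : 2 = K2 `^ q * k `^ e :> R.
  rewrite -powRrM mulVf ?gt_eqF // powRr1 ?divr_ge0 ?(ltW ke) //.
  by rewrite divfK // gt_eqF.
rewrite ler_pM ?powR_ge0 //.
by rewrite ge0_ler_powR // ?nnegrE ltW.
Qed.

(** * The exit time from a ball *)

Section exit.
Context {R : realType} {d : nat}.
Context {dO : measure_display} {Om : measurableType dO}.
Variables (X : R -> Om -> 'cV[R]_d) (x : 'cV[R]_d) (r : R).

Lemma exit_time_le w (u : R) :
  0 < u -> r < enorm (X u w - x) -> (exit_time X x r w <= u%:E)%E.
Proof. by move=> u0 ru; apply: ereal_inf_lbound; exists u. Qed.

Lemma le_exit_timeP w (s : R) :
  (s%:E <= exit_time X x r w)%E <->
  forall u, 0 < u -> u < s -> enorm (X u w - x) <= r.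
Proof.
split=> [sT u u0 us|h].
  rewrite leNgt; apply/negP => ru.
  have := le_trans sT (exit_time_le _ _ u0 ru).
  by rewrite lee_fin leNgt us.
apply: le_ereal_inf_tmp => _ [u [u0 ru] <-]; rewrite lee_fin leNgt.
by apply/negP => us; move: (h u u0 us); rewrite leNgt ru.
Qed.

Hypothesis cadX : forall w, cadlag (X^~ w).

(** By right continuity an exit before s is witnessed at a rational time, which
    makes the event a countable intersection. *)
Lemma le_exit_time_rat w (s : R) :
  (s%:E <= exit_time X x r w)%E <->
  forall q : rat, 0 < (ratr q : R) -> (ratr q : R) < s ->
    enorm (X (ratr q) w - x) <= r.
Proof.
split=> [/le_exit_timeP h q q0 qs|h]; first exact: h.
apply/le_exit_timeP => u u0 us; rewrite leNgt; apply/negP => ru.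
have Xu : enorm (X v w - x) @[v --> u^'+] --> enorm (X u w - x).
  apply: (continuous_cvg _ (continuous_edist x (X u w))).
  by have [+ _] := cadX w; apply; exact: ltW.
have : \forall v \near u^'+, r < enorm (X v w - x).
  by apply: (cvgr_gt _ Xu).
case/nbhs_ballP => e e0 he.
have /rat_in_itvoo [q] : u < Num.min (u + e) s.
  by rewrite lt_min us ltrDl e0.
rewrite in_itv /= lt_min => /and3P[uq qe qs].
have := h q (lt_trans u0 uq) qs; rewrite leNgt he //=.
rewrite /ball /= ltr_norml; apply/andP; split; lra.
Qed.

(** The event that s <= T only involves the path strictly before s, so it is in
    F_s although T is the hitting time of an open set, for which the event
    T <= s may need information from right after s. *)
Lemma natural_filtration_le_exit_time (s : R) :
  natural_filtration X s [set w | (s%:E <= exit_time X x r w)%E].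
Proof.
pose gen : set (set Om) := [set A | exists (u : R) B,
  [/\ 0 <= u, u <= s, measurable B & A = X u @^-1` B]].
pose OmF := g_sigma_algebraType gen.
suff : @measurable _ OmF [set w | (s%:E <= exit_time X x r w)%E] by [].
pose miss (q : rat) : set OmF := [set w |
  [/\ 0 < (ratr q : R), (ratr q : R) < s & r < enorm (X (ratr q) w - x)]].
rewrite (_ : [set _ | _] = ~` \bigcup_q miss q); last first.
  apply/seteqP; split => w /=.
    move=> /le_exit_time_rat h [q _ [q0 qs]].
    by rewrite ltNge h.
  move=> h; apply/le_exit_time_rat => q q0 qs; rewrite leNgt; apply/negP => rq.
  by apply: h; exists q.
apply: measurableC; apply: bigcupT_measurable_rat => q.
have [/andP[q0 qs]|nq] := boolP ((0 < (ratr q : R)) && ((ratr q : R) < s)).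
  apply: sub_sigma_algebra; exists (ratr q), [set y | r < enorm (y - x)].
  split; [exact: ltW|exact: ltW|exact: measurable_enorm_gt|].
  by apply/seteqP; split => w //= [].
rewrite (_ : miss q = set0) //.
by rewrite -subset0 => w [q0 qs _]; rewrite q0 qs in nq.
Qed.

Hypothesis measX : forall t : R, 0 <= t -> measurable_fun setT (X t).

Lemma measurable_le_exit_time (s : R) :
  measurable [set w | (s%:E <= exit_time X x r w)%E].
Proof.
have := natural_filtration_le_exit_time s.
apply: smallest_sub; first exact: sigma_algebra_measurable.
move=> _ [u [B [u0 _ mB ->]]]; rewrite -[X in measurable X]setTI.
exact: measX.
Qed.

Lemma sup_dist_leE w (t : R) : 0 <= t ->
  (sup_dist X x t w <= r%:E)%E <->
  [/\ enorm (X 0 w - x) <= r, (t%:E <= exit_time X x r w)%E &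
      enorm (X t w - x) <= r].
Proof.
move=> t0; split => [supr|[X0r tT Xtr]].
  have h s : 0 <= s <= t -> enorm (X s w - x) <= r.
    move=> st; rewrite -lee_fin; apply: le_trans supr; apply: ereal_sup_ubound.
    by exists s => //=; rewrite in_itv.
  split; [by rewrite h // lexx| |by rewrite h // t0 lexx].
  by apply/le_exit_timeP => u u0 ut; rewrite h // !ltW.
apply: ge_ereal_sup => z [s /=]; rewrite in_itv /= => /andP[s0 st] <-.
rewrite lee_fin; move: s0 st; rewrite le_eqVlt => /predU1P[<- //|s0].
rewrite le_eqVlt => /predU1P[-> //|st].
by move/le_exit_timeP: tT; exact.
Qed.

Lemma measurable_sup_dist_le (t : R) : 0 <= t ->
  measurable [set w | (sup_dist X x t w <= r%:E)%E].
Proof.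
move=> t0; pose near s := X s @^-1` [set y | enorm (y - x) <= r].
have mnear s : 0 <= s -> measurable (near s).
  move=> s0; rewrite -[near s]setTI; apply: measX => //.
  exact: measurable_enorm_le.
rewrite (_ : [set _ | _] =
    near 0 `&` [set w | (t%:E <= exit_time X x r w)%E] `&` near t).
  by repeat apply: measurableI; [exact: mnear|exact: measurable_le_exit_time|
    exact: mnear].
by apply/seteqP; split => w /=; [case/sup_dist_leE|case=> -[? ?] ?;
  apply/sup_dist_leE].
Qed.

(** The stochastic interval from 0 to min(t, T), closed on the right: this
    is what makes it predictable, and it retains the jump at time T. *)
Definition before_exit (t : R) : set (Om * R) :=
  [set z | 0 <= z.2 /\ (z.2 <= t /\ (z.2%:E <= exit_time X x r z.1)%E)].

(** For fixed w the indicator of u <= min(t, T w) is left-continuous in u. *)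
Lemma predictable_before_exit (t : R) :
  predictable_gen (natural_filtration X) (before_exit t).
Proof.
pose Q (u : R) : set Om := [set w | u <= t /\ (u%:E <= exit_time X x r w)%E].
exists (fun u => \1_(Q u)), [set 1]; split => //.
- move=> u u0 B mB.
  pose gen : set (set Om) := [set A | exists (s : R) B,
    [/\ 0 <= s, s <= u, measurable B & A = X s @^-1` B]].
  pose OmF := g_sigma_algebraType gen.
  suff mQ : @measurable _ OmF (Q u).
    have : @measurable _ OmF (setT `&` \1_(Q u) @^-1` B).
      by apply: (@measurable_indic _ OmF R) => //.
    by rewrite setTI.
  have [ut|tu] := leP u t.
    rewrite (_ : Q u = [set w | (u%:E <= exit_time X x r w)%E]).
      exact: natural_filtration_le_exit_time.
    by apply/seteqP; split => w /=; [case|].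
  rewrite (_ : Q u = set0) //.
  by rewrite -subset0 => w [ut _]; move: tu; rewrite ltNge ut.
- move=> w t0 t0_gt0; apply: cvg_near_cst.
  have [[t0t t0T]|nQ] := pselect (Q t0 w).
    have : \forall s \near t0^'-, s < t0 by exact: nbhs_left_lt.
    apply: filterS => s st0; rewrite /= !indicE !mem_set //.
    split; first exact: ltW (lt_le_trans st0 t0t).
    by apply: le_trans t0T; rewrite lee_fin ltW.
  suff [s0 s0t0 hs0] : exists2 s0, s0 < t0 & forall s, s0 < s -> ~ Q s w.
    have : \forall s \near t0^'-, s0 < s by exact: nbhs_left_gt.
    by apply: filterS => s /hs0 nQs; rewrite /= !indicE !memNset.
  have [t0t|tt0] := leP t0 t; last first.
    by exists t => // s ts [st _]; move: ts; rewrite ltNge st.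
  have : ~ (t0%:E <= exit_time X x r w)%E by move=> t0T; apply: nQ.
  move=> /le_exit_timeP /existsNP [u /not_implyP [u0 /not_implyP [ut0 ru]]].
  exists u => // s us [_ /le_exit_timeP /(_ u u0 us)]; exact: ru.
- apply/seteqP; split => -[w s] /=; rewrite indicE => -[s0 h]; split => //;
  [by rewrite mem_set|move: h].
  have [/set_mem //|_ /esym /eqP] := boolP (w \in Q s).
  by rewrite oner_eq0.
Qed.

End exit.

(** * Jumps before the exit time and the estimate *)

Lemma esum_le1 {R : realType} {T : choiceType} (S : set T) (a : T -> \bar R) :
  (forall s, S s -> (0 <= a s <= 1)%E) ->
  (forall s s', S s -> S s' -> a s != 0%E -> a s' != 0%E -> s = s') ->
  (\esum_(s in S) a s <= 1)%E.
Proof.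
move=> a01 uniq.
have [[s0 [Ss0 as0]]|none] := pselect (exists s0, S s0 /\ a s0 != 0%E).
  have -> : \esum_(s in S) a s = \esum_(s in S `&` [set s0]) a s.
    rewrite esum_mkcondr; apply: eq_esum => s Ss.
    case: ifPn => // /negP ss0; apply/eqP/negPn/negP => as0'.
    by apply: ss0; rewrite inE; exact: uniq.
  have -> : S `&` [set s0] = [set s0].
    by apply/seteqP; split => [s []//|s ->].
  by rewrite esum_set1; case/andP: (a01 _ Ss0).
rewrite esum1 // => s Ss; apply/eqP/negPn/negP => as0.
by apply: none; exists s.
Qed.

(** This weak form of the triangle inequality follows from
    (s - t)^2 <= 2 s^2 + 2 t^2 in each coordinate. *)
Lemma enorm_sub_le {R : realType} {d} (u v : 'cV[R]_d) (r : R) :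
  enorm u <= r -> enorm v <= r -> enorm (u - v) <= 2 * r.
Proof.
move=> ur vr; have r0 : 0 <= r := le_trans (sqrtr_ge0 _) ur.
rewrite -(@ler_pXn2r _ 2) // ?nnegrE ?mulr_ge0 ?sqrtr_ge0 //.
have : enorm u ^+ 2 <= r ^+ 2 by rewrite ler_pXn2r // nnegrE sqrtr_ge0.
have : enorm v ^+ 2 <= r ^+ 2 by rewrite ler_pXn2r // nnegrE sqrtr_ge0.
suff : enorm (u - v) ^+ 2 <= 2 * enorm u ^+ 2 + 2 * enorm v ^+ 2 by lra.
rewrite !enorm_sqr !mulr_sumr -big_split /=; apply: ler_sum => i _.
rewrite !mxE; have := sqr_ge0 (u i 0 + v i 0); nra.
Qed.

Lemma enorm_left_lim_le {R : realType} {d} {dO} {Om : measurableType dO}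
    (X : R -> Om -> 'cV[R]_d) (x : 'cV[R]_d) (r s : R) (w : Om) :
  cadlag (X^~ w) -> 0 < s -> (s%:E <= exit_time X x r w)%E ->
  enorm (lim (X u w @[u --> s^'-]) - x) <= r.
Proof.
move=> [_ /(_ s) cX] s0 /le_exit_timeP sT.
have cl : closed [set y : 'cV[R]_d | enorm (y - x) <= r].
  rewrite -[X in closed X]/((fun y => enorm (y - x)) @^-1` [set u | u <= r]).
  apply: closed_comp; last exact: closed_le.
  by move=> y _; exact: continuous_edist.
apply: (closed_cvg _ cl _ _ (cX s0)).
have : \forall u \near s^'-, 0 < u by exact: nbhs_left_gt.
have : \forall u \near s^'-, u < s by exact: nbhs_left_lt.
by apply: filterS2 => u us u0 /=; exact: sT.
Qed.

(** Up to and including T the left limits lie in the closed ball, and strictly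
    before T so do the values of the path; a jump longer than the diameter must
    therefore lead out of the ball. *)
Lemma exit_time_big_jump {R : realType} {d} {dO} {Om : measurableType dO}
    (X : R -> Om -> 'cV[R]_d) (x : 'cV[R]_d) (r s : R) (w : Om) :
  cadlag (X^~ w) -> 0 < s -> (s%:E <= exit_time X x r w)%E ->
  2 * r < enorm (jump X s w) -> exit_time X x r w = s%:E.
Proof.
move=> cX s0 sT big; apply/eqP; rewrite eq_le sT andbT.
apply: exit_time_le => //; rewrite ltNge; apply/negP => Xs.
move: big; rewrite ltNge => /negP; apply.
have -> : jump X s w = (X s w - x) - (lim (X u w @[u --> s^'-]) - x).
  by rewrite /jump opprB addrA subrK.
by apply: enorm_sub_le => //; exact: enorm_left_lim_le.
Qed.

Lemma osl_levy_set0 {R : realType} {d} (E : 'cV[R]_d -> 'M[R]_d)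
    (sigma : {finite_measure set 'cV[R]_d -> \bar R}) (x : 'cV[R]_d) :
  osl_levy E sigma x set0 = 0%E.
Proof.
apply: integral0_eq => theta _; apply: integral0_eq => s _.
by rewrite indic0 mul0r.
Qed.

Lemma osl_levy_ge0 {R : realType} {d} (E : 'cV[R]_d -> 'M[R]_d)
    (sigma : {finite_measure set 'cV[R]_d -> \bar R}) (x : 'cV[R]_d)
    (A : set 'cV[R]_d) : (0 <= osl_levy E sigma x A)%E.
Proof.
apply: integral_ge0 => theta _; apply: integral_ge0 => s _.
by rewrite lee_fin divr_ge0 // sqr_ge0.
Qed.

Lemma osl_nu_set0 {R : realType} {d} (E : 'cV[R]_d -> 'M[R]_d)
    (sigma : {finite_measure set 'cV[R]_d -> \bar R}) {dO}
    {Om : measurableType dO} (X : R -> Om -> 'cV[R]_d) (w : Om) :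
  osl_nu E sigma X w set0 = 0%E.
Proof.
by apply: integral0_eq => s _; rewrite xsection0 osl_levy_set0.
Qed.

(** The compensator formula is applied to W, the indicator of the jumps longer
    than 2 r up to min(t, T): the expected number of such jumps is at most 1,
    and it is at least t P^x(T >= t) times the lower bound c of the jump rate. *)
Lemma exit_time_tail {R : realType} {d} (E : 'cV[R]_d -> 'M[R]_d) (a b : R)
    (sigma : {finite_measure set 'cV[R]_d -> \bar R}) {dO}
    {Om : measurableType dO} (P : 'cV[R]_d -> probability Om R)
    (X : R -> Om -> 'cV[R]_d) (x : 'cV[R]_d) (t r m : R) :
  bounded_admissible E a b -> symmetric_spherical sigma ->
  (0 < sigma setT)%E -> osl_process E sigma P X ->
  0 < t -> 0 < m -> 2 * r <= m `^ a -> 2 * r <= m `^ b ->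
  (P x [set w | (t%:E <= exit_time X x r w)%E] <=
    (4 * m / fine (sigma setT) / t)%:E)%E.
Proof.
move=> hE hs sigma0 hX t0 m0 ma mb.
have cX := osl_cadlag hX; have mX := osl_meas hX.
pose U := [set y : 'cV[R]_d | 2 * r < enorm y].
have mU : measurable U.
  rewrite (_ : U = [set y | 2 * r < enorm (y - 0)]).
    exact: measurable_enorm_gt.
  by apply/seteqP; split => y /=; rewrite subr0.
pose c : R := (4 * m)^-1 * fine (sigma setT).
have sigma_fin : sigma setT = (fine (sigma setT))%:E.
  by rewrite fineK ?fin_num_measure.
have fs0 : 0 < fine (sigma setT) by rewrite -lte_fin -sigma_fin.
have c0 : 0 < c by rewrite mulr_gt0 // invr_gt0 mulr_gt0.
have levyU y : (c%:E <= osl_levy E sigma y U)%E.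
  rewrite EFinM -sigma_fin.
  exact: (osl_levy_tail_ge E a b sigma (2 * r) m y hE hs m0 ma mb).
pose W (w : Om) (s : R) (y : 'cV[R]_d) : \bar R :=
  (\1_(before_exit X x r t `*` U) ((w, s), y))%:E.
have W0 w s y : (0 <= W w s y)%E by rewrite lee_fin.
have [_ _ _ _ /(_ W)] := osl_char hX x.
case=> // [|_ eqW].
  pose OmR := g_sigma_algebraType (predictable_gen (natural_filtration X)).
  have mA : @measurable _ (OmR * 'cV[R]_d)%type (before_exit X x r t `*` U).
    apply: measurableX => //; apply: sub_sigma_algebra.
    exact: predictable_before_exit.
  have mW : @measurable_fun _ _ (OmR * 'cV[R]_d)%type _ setT
      (EFin \o (\1_(before_exit X x r t `*` U) : _ -> R)).
    by apply/measurable_EFinP; exact: measurable_indic.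
  rewrite /predictable_fun (_ : (fun z => _) =
    EFin \o (\1_(before_exit X x r t `*` U) : _ -> R)).
    exact: measurable_funTS mW.
  by apply/funext => -[[w s] y].
have jumps : (\int[P x]_w star_jumps_oo X W w <= 1)%E.
  apply: integral_le1 => w; first by apply: esum_ge0 => s _.
  apply: esum_le1 => [s _|s s' [s0 _] [s'0 _]].
    by rewrite W0 lee_fin indicE lern1 leq_b1.
  have onlyT u : 0 < u -> W w u (jump X u w) != 0%E ->
      exit_time X x r w = u%:E.
    move=> u0; rewrite /W indicE eqe pnatr_eq0 eqb0 negbK => /set_mem.
    case=> /= [[_ [_ uT]]] uU.
    exact: exit_time_big_jump.
  by move=> /(onlyT s s0) e /(onlyT s' s'0); rewrite e => -[].
have nu_ge w : (t%:E <= exit_time X x r w)%E ->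
    ((c * t)%:E <= star_meas_oo (osl_nu E sigma X) W w)%E.
  move=> tT.
  have nuA : (c%:E * t%:E <= osl_nu E sigma X w (`[0%R, t] `*` U))%E.
    have -> : t%:E = lebesgue_measure (`[0%R, t]%classic : set R).
      by rewrite lebesgue_measure_itv /= lte_fin t0 sube0.
    apply: integral_ge_cst => //.
    - by move=> s /=; rewrite !in_itv /= => /andP[-> _].
    - exact: ltW.
    - by move=> s _; exact: osl_levy_ge0.
    move=> s /= st; rewrite (_ : xsection _ s = U) //.
    by apply/seteqP; split => y; rewrite /xsection /= inE /=; [case|].
  rewrite EFinM; apply: le_trans nuA _; rewrite -[leLHS]mul1e.
  apply: integral_ge_cst => //.
  - exact: osl_nu_set0.
  - exact: measurableX.
  - by move=> [s y] /= [+ _]; rewrite !in_itv /= => /andP[-> _].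
  move=> [s y] /= [+ yU]; rewrite in_itv /= => /andP[s0 st].
  rewrite /W indicE mem_set //=; split => //=; split => //=; split => //=.
  by apply: le_trans tT; rewrite lee_fin.
have := le_trans _ jumps; rewrite eqW => /(_ ((c * t)%:E *
  P x [set w | (t%:E <= exit_time X x r w)%E])%E).
have ct0 : 0 < c * t by exact: mulr_gt0.
have -> : 4 * m / fine (sigma setT) / t = (c * t)^-1.
  by rewrite /c; field; rewrite !gt_eqF.
move=> h; rewrite -[leRHS]mule1 lee_pdivlMl //; apply: h.
apply: integral_ge_cst => //.
- exact: measurable_le_exit_time.
- exact: ltW.
- move=> w _; apply: integral_raw_ge0 => //; exact: osl_nu_set0.
Qed.

(** The two ranges of r only differ by the roles of a and b: p is the exponent
    that governs the rate. For p < q the condition on k means r >= k, for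
    q < p it means r <= k. *)
Lemma exit_time_rate {R : realType} {d} (E : 'cV[R]_d -> 'M[R]_d) (a b : R)
    (sigma : {finite_measure set 'cV[R]_d -> \bar R}) {dO}
    {Om : measurableType dO} (P : 'cV[R]_d -> probability Om R)
    (X : R -> Om -> 'cV[R]_d) (p q k : R) :
  bounded_admissible E a b -> symmetric_spherical sigma ->
  (0 < sigma setT)%E -> osl_process E sigma P X ->
  (p = a /\ q = b) \/ (p = b /\ q = a) -> 0 < k ->
  exists2 C : R, 0 < C & forall x t r, 0 < t -> 0 < r ->
    k `^ (q / p - 1) <= r `^ (q / p - 1) ->
    (P x [set w | (sup_dist X x t w <= r%:E)%E] <=
      (C / t * r `^ p^-1)%:E)%E /\
    (P x [set w | (t%:E <= exit_time X x r w)%E] <=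
      (C / t * r `^ p^-1)%:E)%E.
Proof.
move=> hE hs sigma0 hX pq k0.
have a0 : 0 < a by apply: lt_trans (ba_a_gt hE).
have b0 : 0 < b := lt_le_trans a0 (ba_le hE).
have [p0 q0] : 0 < p /\ 0 < q by case: pq => -[-> ->].
have [K K0 hK] := exists_powR_scale p q k p0 q0 k0.
have fs0 : 0 < fine (sigma setT).
  by rewrite -lte_fin fineK ?fin_num_measure.
exists (4 * K / fine (sigma setT)); first by rewrite divr_gt0 ?mulr_gt0.
move=> x t r t0 r0 /(hK r r0) [mp mq].
have tail : (P x [set w | (t%:E <= exit_time X x r w)%E] <=
    (4 * K / fine (sigma setT) / t * r `^ p^-1)%:E)%E.
  rewrite (_ : _ * _ = 4 * (K * r `^ p^-1) / fine (sigma setT) / t).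
    apply: (exit_time_tail E a b sigma P X x t r (K * r `^ p^-1) hE hs sigma0
      hX t0); first by rewrite mulr_gt0 ?powR_gt0.
    + by case: pq mp mq => -[-> ->].
    + by case: pq mp mq => -[-> ->].
  by field; rewrite !gt_eqF.
split=> //; apply: le_trans tail; apply: le_measure; rewrite ?inE.
- exact: measurable_sup_dist_le (osl_cadlag hX) (osl_meas hX) t (ltW t0).
- exact: measurable_le_exit_time (osl_cadlag hX) (osl_meas hX) t.
- by move=> w /=; case/(sup_dist_leE _ _ _ _ _ (ltW t0)).
Qed.

Theorem corollary3p8 (R : realType) (d : nat)
    (E : 'cV[R]_d -> 'M[R]_d) (a b : R) (hE : bounded_admissible E a b)
    (sigma : {finite_measure set 'cV[R]_d -> \bar R})
    (hsigma : symmetric_spherical sigma)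
    (sigma_neq0 : (0 < sigma setT)%E)
    (dO : measure_display) (Om : measurableType dO)
    (P : 'cV[R]_d -> probability Om R) (X : R -> Om -> 'cV[R]_d)
    (hX : osl_process E sigma P X) :
  let k0 : R := (acos (Num.sqrt (2 / 3)))^-1 in
  exists C1 C2 : R,
    [/\ 0 < C1, 0 < C2,
        forall (x : 'cV[R]_d) (t r : R), 0 < t -> k0^-1 <= r ->
          (P x [set w | (sup_dist X x t w <= r%:E)%E]
             <= (C1 / t * r `^ a^-1)%:E)%E /\
          (P x [set w | (t%:E <= exit_time X x r w)%E]
             <= (C1 / t * r `^ a^-1)%:E)%E &
        forall (x : 'cV[R]_d) (t r : R), 0 < t -> 0 < r -> r <= k0^-1 ->
          (P x [set w | (sup_dist X x t w <= r%:E)%E]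
             <= (C2 / t * r `^ b^-1)%:E)%E /\
          (P x [set w | (t%:E <= exit_time X x r w)%E]
             <= (C2 / t * r `^ b^-1)%:E)%E].
Proof.
move=> k0; have k_gt0 : 0 < k0^-1.
  rewrite invrK; apply: acos_gt0; apply/andP; split.
    by apply: (@le_trans _ _ 0); [rewrite lerN10|exact: sqrtr_ge0].
  by rewrite -[ltRHS]sqrtr1 ltr_sqrt //; lra.
have a0 : 0 < a by apply: lt_trans (ba_a_gt hE).
have ab := ba_le hE; have b0 : 0 < b := lt_le_trans a0 ab.
have [C1 C10 h1] := exit_time_rate E a b sigma P X a b k0^-1 hE hsigma
  sigma_neq0 hX (or_introl (conj erefl erefl)) k_gt0.
have [C2 C20 h2] := exit_time_rate E a b sigma P X b a k0^-1 hE hsigma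
  sigma_neq0 hX (or_intror (conj erefl erefl)) k_gt0.
(* The exponent b / a - 1 is nonnegative and a / b - 1 is nonpositive: hence
   large radii in the first case, small ones in the second. *)
exists C1, C2; split => // [x t r t0 kr|x t r t0 r0 rk].
  have r0 := lt_le_trans k_gt0 kr; apply: h1 => //.
  by rewrite ge0_ler_powR ?nnegrE ?(ltW k_gt0) ?(ltW r0) // subr_ge0
    ler_pdivlMr ?mul1r.
apply: h2 => //; rewrite -(opprB 1) !powRN lef_pV2 ?posrE ?powR_gt0 //.
by rewrite ge0_ler_powR ?nnegrE ?(ltW k_gt0) ?(ltW r0) // subr_ge0
  ler_pdivrMr ?mul1r.
Qed.
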